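(* Let $\mathbf{M}$ be an HPD matrix such that $\lim_{n\to\infty}\lambda_n=\lambda>0$, and let $\mathbf{B}$ be the transition matrix associated with $\mathbf{M}$. Then the matrix $\mathbf{A}=\overline{\mathbf{B}}\mathbf{B}^{t}=(a_{i,j})_{i,j=0}^\infty$ exists and defines the bounded operator $\mathcal{A}=\overline{\mathcal{B}}\,\overline{\mathcal{B}}^{*}$ on $\ell_2$, where $\mathcal{B}$ and $\overline{\mathcal{B}}$ are the bounded operators on $\ell_2$ defined by $\mathbf{B}$ and $\overline{\mathbf{B}}$. Moreover, (1) $a_{i,j}=\lim_{n\to\infty}\mathbf{M}_n^{-1}[i,j]$ for every $i,j\in\mathbb{N}_0$; (2) $\|\mathcal{A}\|=\|\mathcal{B}\|^2=\lambda^{-1}$.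
   Context: An infinite complex matrix $\mathbf{M}=(c_{i,j})_{i,j=0}^\infty$ is HPD if $c_{i,j}=\overline{c_{j,i}}$ for all $i,j$ and $\det\mathbf{M}_n>0$ for all $n\ge0$, where $\mathbf{M}_n=(c_{i,j})_{i,j=0}^n$; $\lambda_n$ is the smallest eigenvalue of $\mathbf{M}_n$ (a non-increasing positive sequence). $\mathbf{M}$ defines an inner product on $\mathbb{C}[z]$ by $\langle z^i,z^j\rangle=c_{i,j}$ (linear in the first variable), with orthonormal polynomials $P_n(z)=\sum_{k=0}^n b_{k,n}z^k$, $b_{n,n}>0$, $\langle P_n,P_m\rangle=\delta_{n,m}$; the transition matrix is the upper triangular matrix $\mathbf{B}=(b_{k,n})_{k,n=0}^\infty$ ($b_{k,n}=0$ for $k>n$). $\overline{\mathbf{B}}$ is the entrywise conjugate. $\mathbf{A}=\overline{\mathbf{B}}\mathbf{B}^t$ exists if all series $a_{i,j}=\sum_{k\ge\max\{i,j\}}\overline{b_{i,k}}\,b_{j,k}$ converge. An infinite matrix defines a bounded operator on $\ell_2$ if $x\mapsto \mathbf{A}x^t$ (formal matrix product) is a well-defined bounded operator $\ell_2\to\ell_2$. $[i,j]$ denotes the $(i,j)$ entry, indices starting at $0$ (for $n\ge\max\{i,j\}$). *)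

(* Defs.v *)
From mathcomp Require Import all_boot all_order all_algebra.
From mathcomp Require Import complex.
From mathcomp Require Import all_classical all_reals all_analysis.
Import Order.TTheory GRing.Theory Num.Theory.
Import numFieldTopology.Exports numFieldNormedType.Exports.

Set Implicit Arguments.
Unset Strict Implicit.
Unset Printing Implicit Defensive.

Local Open Scope classical_set_scope.
Local Open Scope complex_scope.
Local Open Scope ring_scope.

(* Folding R[i] into a numClosedFieldType gives access to the topology and the
   normed module structure that the library puts on such fields. In C R,
   [0 < z] means that z is real and positive, and [x <= y] that y - x is real
   and nonnegative. *)
Definition C (R : realType) : numClosedFieldType := R[i].

Definition imx (R : realType) := nat -> nat -> C R.

Definition imx_conj (R : realType) (X : imx R) : imx R := fun i j => (X i j)^*.

Definition imx_tr (R : realType) (X : imx R) : imx R := fun i j => X j i.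

Definition imx_mul_exists (R : realType) (X Y : imx R) : Prop :=
  forall i j, cvgn (series (fun k => X i k * Y k j)).

(* Meaningful only under [imx_mul_exists X Y]. For X = imx_conj B and
   Y = imx_tr B with B upper triangular, the terms k < max(i, j) vanish. *)
Definition imx_mul (R : realType) (X Y : imx R) : imx R :=
  fun i j => limn (series (fun k => X i k * Y k j)).

Definition section (R : realType) (M : imx R) (n : nat) : 'M[C R]_n.+1 :=
  \matrix_(i, j) M i j.

Definition HPD (R : realType) (M : imx R) : Prop :=
  (forall i j, M i j = (M j i)^* ) /\ (forall n, 0 < \det (section M n)).

Definition smallest_eigenvalue (R : realType) (n : nat) (X : 'M[C R]_n)
    (l : R) : Prop :=
  eigenvalue X (l%:C : C R) /\
  (forall mu : C R, eigenvalue X mu -> (l%:C : C R) <= mu).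

(* The sesquilinear form with <z^i, z^j> = M i j, linear in the first variable. *)
Definition poly_dot (R : realType) (M : imx R) (p q : {poly (C R)}) : C R :=
  \sum_(i < size p) \sum_(j < size q) p`_i * (q`_j)^* * M i j.

Definition orthonormal_polys (R : realType) (M : imx R)
    (P : nat -> {poly (C R)}) : Prop :=
  [/\ forall n, size (P n) = n.+1,
      forall n, 0 < lead_coef (P n)
    & forall n m, poly_dot M (P n) (P m) = (n == m)%:R].

Definition transition_matrix (R : realType) (M B : imx R) : Prop :=
  exists2 P, orthonormal_polys M P & forall k n, B k n = (P n)`_k.

Definition l2 (R : realType) (x : nat -> C R) : Prop :=
  cvgn (series (fun k => (Normc.normc (x k) : R) ^+ 2)).

Definition l2norm (R : realType) (x : nat -> C R) : R :=
  Num.sqrt (limn (series (fun k => (Normc.normc (x k) : R) ^+ 2))).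

Definition l2dot (R : realType) (x y : nat -> C R) : C R :=
  limn (series (fun k => x k * (y k)^* )).

(* Operators on l2 are represented by functions on all sequences; only their
   values on l2 are relevant. *)
Definition bounded_operator (R : realType)
    (T : (nat -> C R) -> (nat -> C R)) : Prop :=
  [/\ forall x, l2 x -> l2 (T x),
      forall a x y, l2 x -> l2 y ->
        T (fun k => a * x k + y k) = (fun k => a * T x k + T y k)
    & exists c : R, forall x, l2 x -> l2norm (T x) <= c * l2norm x].

Definition opnorm (R : realType)
    (T : (nat -> C R) -> (nat -> C R)) : R :=
  sup [set l2norm (T x) | x in [set x | l2 x /\ l2norm x <= 1]].

(* S is the Hilbert space adjoint of T, unique as an operator on l2. *)
Definition adjoint (R : realType)
    (T S : (nat -> C R) -> (nat -> C R)) : Prop :=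
  bounded_operator S /\
  forall x y, l2 x -> l2 y -> l2dot (T x) y = l2dot x (S y).

(* The formal product x |-> X x^t. *)
Definition imx_op (R : realType) (X : imx R) (x : nat -> C R) : nat -> C R :=
  fun i => limn (series (fun k => X i k * x k)).

Definition defines_bounded_operator (R : realType) (X : imx R) : Prop :=
  (forall x, l2 x -> forall i, cvgn (series (fun k => X i k * x k))) /\
  bounded_operator (imx_op X).

(* Main.v *)
Require Import Defs.
From mathcomp Require Import all_boot all_order all_algebra.
From mathcomp Require Import complex.
From mathcomp Require Import all_classical all_reals all_analysis.
From mathcomp Require Import lra.
Import Order.TTheory GRing.Theory Num.Theory.
Import numFieldTopology.Exports numFieldNormedType.Exports.

Local Open Scope classical_set_scope.
Local Open Scope ring_scope.

Set Implicit Arguments.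
Unset Strict Implicit.
Unset Printing Implicit Defensive.

Import Normc.

(** Let P_n be the orthonormal polynomials. A finitely supported sequence x is
    the list of coordinates of the polynomial sum_k x_k P_k, whose coefficients
    form the vector B x. Hence the form of M takes the value |x|^2 on B x
    ([transition_matrix_orthonormal]): in sections, B_n^t M_n conj(B_n) = 1, so
    that M_n^-1 = conj(B_n) B_n^t ([invmx_section]). The entries of M_n^-1 are
    therefore partial sums of the series that define A, and the limit formula
    for a_ij holds as soon as these series converge.

    Since the form of M_n is at least l_n |v|^2 ([smallest_eigenvalue_le]), the
    identity above gives l_n |B x|^2 <= |x|^2, and in the limit every section of
    B has norm at most lambda^(-1/2) ([transition_sections_bounded]). Such a
    bound on sections passes to conjugates and transposes by finite sums alone
    ([sections_bounded_conj], [sections_bounded_tr]), and it is equivalent to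
    defining an operator with that bound ([sections_bounded_operator],
    [sections_bounded_by], [bounded_by_sections]). Rows and columns of B are then
    square summable, so A exists. The operators conj(B) and B^t are adjoint, and
    A is their composite: both facts compare a bounded linear functional of x
    with its expansion along the standard basis ([bounded_functional_series]).

    This gives |B| <= lambda^(-1/2) and |A| <= lambda^(-1). Conversely, if
    v M_n = l_n v for a row v, then v = l_n v conj(B_n) B_n^t, so that
    |v|^2 = l_n |v conj(B_n)|^2. Hence any bound c for the sections of the
    conjugate transpose of B satisfies 1 <= l_n c^2 for all n, that is,
    lambda^-1 <= c^2 ([transition_adjoint_lower]). The number |B| is such a
    bound, and so is |A|^(1/2) by the C*-identity for conj(B) and its adjoint
    B^t ([adjoint_bounded_by]). *)

(** * Moduli and convergence of complex numbers *)

Section Modulus.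
Variable R : realType.
Implicit Types (z w : C R) (u v : nat -> C R).

Lemma normC_normc z : `|z| = ((normc z)%:C)%C.
Proof. by rewrite [LHS](normc_def z); case: z. Qed.

Lemma normc_ge0 z : 0 <= normc z.
Proof. by case: z => a b; exact: sqrtr_ge0. Qed.

Lemma normc_mul z w : normc (z * w) = normc z * normc w.
Proof. exact: normcM. Qed.

Lemma normc_add z w : normc (z + w) <= normc z + normc w.
Proof. exact: le_normcD. Qed.

Lemma normc_opp z : normc (- z) = normc z.
Proof. exact: normcN. Qed.

Lemma normc_conj z : normc z^* = normc z.
Proof.
have: `|z^*| = `|z| by rewrite norm_conjC.
by rewrite !normC_normc => -[].
Qed.

Lemma normc_subC z w : normc (z - w) = normc (w - z).
Proof. by rewrite -normc_opp opprB. Qed.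

Lemma normc_real (r : R) : normc ((r%:C)%C : C R) = `|r|.
Proof. by rewrite /normc /= expr0n addr0 sqrtr_sqr. Qed.

Lemma mulC_conj z : z * z^* = ((normc z ^+ 2)%:C)%C.
Proof. by rewrite -normCK normC_normc -rmorphXn. Qed.

Lemma normc_sum (n : nat) u :
  normc (series u n) <= series (fun k => normc (u k)) n.
Proof.
rewrite /series /=; elim: n => [|n IH]; first by rewrite !big_nil normc0.
by rewrite !big_nat_recr //= (le_trans (normc_add _ _)) // lerD2r.
Qed.

Lemma realC_sum (n : nat) (r : nat -> R) :
  series (fun k => (((r k)%:C)%C : C R)) n = ((series r n)%:C)%C.
Proof. by rewrite /series /= rmorph_sum. Qed.

Lemma cvg_normcP u z :
  u n @[n --> \oo] --> z <-> normc (u n - z) @[n --> \oo] --> (0 : R).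
Proof.
split=> [/cvgrPdist_lt uz|/cvgrPdist_lt uz]; apply/cvgrPdist_lt => e e0.
  have e0' : 0 < ((e%:C)%C : C R) by rewrite ltcR.
  near=> n; have : `|z - u n| < (e%:C)%C by near: n; exact: uz e0'.
  by rewrite normC_normc ltcR sub0r normrN ger0_norm ?normc_ge0 // normc_subC.
have eE : e = ((normc e)%:C)%C by rewrite -normC_normc gtr0_norm.
have e0' : 0 < normc e by rewrite -ltcR -eE.
near=> n; have : `|0 - normc (u n - z)| < normc e by near: n; exact: uz e0'.
rewrite [X in _ -> _ < X]eE normC_normc ltcR sub0r normrN.
by rewrite ger0_norm ?normc_ge0 // normc_subC.
Unshelve. all: by end_near. Qed.

Lemma cvg_normc u z :
  u n @[n --> \oo] --> z -> normc (u n) @[n --> \oo] --> normc z.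
Proof.
move=> /cvg_normcP /cvgrPdist_lt uz; apply/cvgrPdist_lt => e e0.
near=> n; have : `|0 - normc (u n - z)| < e by near: n; exact: uz e0.
rewrite sub0r normrN (ger0_norm (normc_ge0 _)); apply: le_lt_trans.
rewrite ler_norml; apply/andP; split.
  by rewrite lerNl opprB lerBlDr -{1}[u n](subrK z) normc_add.
by rewrite lerBlDr normc_subC -{1}[z](subrK (u n)) normc_add.
Unshelve. all: by end_near. Qed.

Lemma cvg_conjC u z :
  u n @[n --> \oo] --> z -> (u n)^* @[n --> \oo] --> z^*.
Proof.
move=> /cvg_normcP uz; apply/cvg_normcP.
rewrite (_ : (fun n => _) = (fun n => normc (u n - z))) //.
by apply/funext => n; rewrite -rmorphB normc_conj.
Qed.

Lemma cvg_realC (r : nat -> R) (a : R) : r n @[n --> \oo] --> a ->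
  (((r n)%:C)%C : C R) @[n --> \oo] --> (((a%:C)%C) : C R).
Proof.
move=> ra; apply/cvg_normcP.
rewrite (_ : (fun n => _) = (fun n => `|r n - a|)); last first.
  by apply/funext => n; rewrite -normc_real rmorphB.
by rewrite -(normr0 R) -(subrr a); apply: cvg_norm; apply: cvgB ra (cvg_cst _).
Qed.

(** The real and imaginary parts are dominated by the modulus, so that their
    series converge absolutely. *)
Lemma cvg_series_normc u :
  cvgn (series (fun k => normc (u k))) -> cvgn (series u).
Proof.
move=> cu.
have part (f : C R -> R) : (forall z, `|f z| <= normc z) ->
    cvgn (series (fun k => f (u k))).
  move=> fle; apply: normed_cvg.
  apply: series_le_cvg cu => [k|k|k]; [exact: normr_ge0|exact: normc_ge0|].
  exact: fle.
have hRe z : `|complex.Re z| <= normc z.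
  by case: z => a b /=; rewrite -sqrtr_sqr ler_wsqrtr // lerDl sqr_ge0.
have hIm z : `|complex.Im z| <= normc z.
  by case: z => a b /=; rewrite -sqrtr_sqr ler_wsqrtr // lerDr sqr_ge0.
have /cvg_realC cRe := part (@complex.Re R) hRe.
have /cvg_realC cIm := part (@complex.Im R) hIm.
have decomp z : z = ((complex.Re z)%:C)%C + 'i * ((complex.Im z)%:C)%C :> C R.
  exact: complexE.
pose r n : C R := ((series (fun k => complex.Re (u k)) n)%:C)%C.
pose s n : C R := ((series (fun k => complex.Im (u k)) n)%:C)%C.
have -> : series u = (fun n => r n + 'i * s n).
  apply/funext => n; rewrite /r /s -!realC_sum /series /= mulr_sumr -big_split /=.
  by apply: eq_bigr => k _; exact: decomp.
apply: is_cvgD; first by apply/cvg_ex; eexists; exact: cRe.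
by apply: is_cvgM; [exact: is_cvg_cst|apply/cvg_ex; eexists; exact: cIm].
Qed.

End Modulus.

(** * The space l2 *)

(** Bounds are stated on these partial sums, because they make sense before
    square summability is known and imply it. *)
Definition nsq (R : realType) (x : nat -> C R) : nat -> R :=
  series (fun k => normc (x k) ^+ 2).

Definition trunc (R : realType) (n : nat) (x : nat -> C R) : nat -> C R :=
  fun k => if (k < n)%N then x k else 0.

Definition delta (R : realType) (k : nat) : nat -> C R := fun m => (m == k)%:R.

Lemma cauchy_schwarz_sum (R : realType) (a b : nat -> R) (n : nat) :
  series (fun k => a k * b k) n ^+ 2 <=
  series (fun k => a k ^+ 2) n * series (fun k => b k ^+ 2) n.
Proof.
rewrite /series /=; elim: n => [|n IH]; first by rewrite !big_nil expr0n /= mulr0.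
rewrite !big_nat_recr //=.
set s := \sum_(_ <= _ < _) _ in IH *; set p := \sum_(_ <= _ < _) _ in IH *.
set q := \sum_(_ <= _ < _) _ in IH *.
have p0 : 0 <= p by apply: sumr_ge0 => k _; exact: sqr_ge0.
have q0 : 0 <= q by apply: sumr_ge0 => k _; exact: sqr_ge0.
(* By the induction hypothesis the product of the two summands on the right is
   at least the square of s * (a n * b n); the inequality is then the one
   between the arithmetic and geometric means. *)
have cross : 2 * s * (a n * b n) <= p * b n ^+ 2 + a n ^+ 2 * q.
  have m0 : 0 <= p * b n ^+ 2 + a n ^+ 2 * q.
    by apply: addr_ge0; apply: mulr_ge0 => //; exact: sqr_ge0.
  have [/le_trans -> //|s0] := leP (2 * s * (a n * b n)) 0.
  rewrite -ler_sqr ?nnegrE //; last exact: ltW.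
  have := sqr_ge0 (p * b n ^+ 2 - a n ^+ 2 * q).
  have := ler_wpM2r (mulr_ge0 (sqr_ge0 (a n)) (sqr_ge0 (b n))) IH.
  nra.
nra.
Qed.

Section L2.
Variable R : realType.
Implicit Types (x y : nat -> C R) (n : nat) (c : R).

Lemma nsq_ge0 x n : 0 <= nsq x n.
Proof. by apply: sumr_ge0 => k _; exact: sqr_ge0. Qed.

Lemma nsqS x n : nsq x n.+1 = nsq x n + normc (x n) ^+ 2.
Proof. by rewrite /nsq /series /= big_nat_recr. Qed.

Lemma nsq_nondecreasing x m n : (m <= n)%N -> nsq x m <= nsq x n.
Proof. by move=> mn; apply: nondecreasing_series mn => k _ _; exact: sqr_ge0. Qed.

Lemma nsqE x n : ((nsq x n)%:C)%C = series (fun k => x k * (x k)^*) n :> C R.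
Proof. by rewrite -realC_sum; apply: eq_bigr => k _; rewrite mulC_conj. Qed.

Lemma nsq_conj x n : nsq (fun k => (x k)^*) n = nsq x n.
Proof. by apply: eq_bigr => k _; rewrite normc_conj. Qed.

Lemma nsq_trunc x n m : nsq (trunc n x) m = nsq x (minn m n).
Proof.
elim: m => [|m IH]; first by rewrite min0n /nsq /series /= !big_nil.
rewrite nsqS IH /trunc; case: ltnP => mn; first by rewrite (minn_idPl mn) nsqS.
rewrite normc0 expr0n /= addr0.
by rewrite (minn_idPr (leq_trans mn (leqnSn m))).
Qed.

Lemma cauchy_schwarz_series x y n :
  normc (series (fun k => x k * y k) n) ^+ 2 <= nsq x n * nsq y n.
Proof.
apply: le_trans (cauchy_schwarz_sum _ _ n).
rewrite ler_sqr ?nnegrE ?normc_ge0 //; last first.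
  by apply: sumr_ge0 => k _; rewrite mulr_ge0 ?normc_ge0.
apply: le_trans (normc_sum _ _) _.
rewrite le_eqVlt; apply/orP; left; apply/eqP; apply: eq_bigr => k _.
exact: normc_mul.
Qed.

Lemma l2norm_ge0 x : 0 <= l2norm x.
Proof. exact: sqrtr_ge0. Qed.

Lemma nsq_le_l2norm x n : l2 x -> nsq x n <= l2norm x ^+ 2.
Proof.
move=> lx; have h m : nsq x m <= limn (nsq x).
  by apply: nondecreasing_cvgn_le lx m; exact: nsq_nondecreasing.
by rewrite /l2norm sqr_sqrtr // (le_trans (nsq_ge0 x 0)).
Qed.

Lemma cvg_nsq x : l2 x -> nsq x n @[n --> \oo] --> l2norm x ^+ 2.
Proof.
move=> lx; rewrite /l2norm sqr_sqrtr //.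
by apply: limr_ge lx _; near=> n; exact: nsq_ge0.
Unshelve. all: by end_near. Qed.

Lemma l2_bounded x c : (forall n, nsq x n <= c) -> l2 x.
Proof.
move=> xc; apply: nondecreasing_is_cvgn; first exact: nsq_nondecreasing.
by exists c => _ [n _ <-]; exact: xc.
Qed.

Lemma l2norm_le x c : 0 <= c -> (forall n, nsq x n <= c ^+ 2) -> l2norm x <= c.
Proof.
move=> c0 xc; have lx := l2_bounded xc.
rewrite -ler_sqr ?nnegrE ?l2norm_ge0 //.
apply: ler_cvg_to (cvg_nsq lx) (cvg_cst (c ^+ 2)) _.
by near=> n; exact: xc.
Unshelve. all: by end_near. Qed.

Lemma l2_trunc x n : l2 (trunc n x).
Proof.
apply: (@l2_bounded _ (nsq x n)) => m.
by rewrite nsq_trunc nsq_nondecreasing ?geq_minr.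
Qed.

Lemma l2norm_trunc x n : l2norm (trunc n x) ^+ 2 = nsq x n.
Proof.
have h := cvg_nsq (@l2_trunc x n).
apply/eqP; rewrite eq_le; apply/andP; split.
  apply: ler_cvg_to h (cvg_cst (nsq x n)) _.
  by near=> m; rewrite nsq_trunc nsq_nondecreasing ?geq_minr.
by rewrite -{1}(minnn n) -nsq_trunc nsq_le_l2norm //; exact: l2_trunc.
Unshelve. all: by end_near. Qed.

Lemma l2_conj x : l2 x -> l2 (fun k => (x k)^*).
Proof.
move=> lx; apply: (@l2_bounded _ (l2norm x ^+ 2)) => n.
by rewrite nsq_conj nsq_le_l2norm.
Qed.

Lemma l2norm_conj x : l2norm (fun k => (x k)^*) = l2norm x.
Proof.
rewrite /l2norm; congr (Num.sqrt (limn _)); apply/funext => n.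
exact: nsq_conj.
Qed.

Lemma l2_lin (a : C R) x y : l2 x -> l2 y -> l2 (fun k => a * x k + y k).
Proof.
move=> lx ly.
apply: (@l2_bounded _ (2 * normc a ^+ 2 * l2norm x ^+ 2 + 2 * l2norm y ^+ 2)) => n.
apply: (@le_trans _ _ (2 * normc a ^+ 2 * nsq x n + 2 * nsq y n)).
  rewrite /nsq /series /= !mulr_sumr -big_split /=; apply: ler_sum => k _.
  have := normc_add (a * x k) (y k); rewrite normc_mul.
  have := sqr_ge0 (normc a * normc (x k) - normc (y k)).
  have := normc_ge0 (a * x k + y k).
  nra.
by rewrite lerD // ler_wpM2l ?nsq_le_l2norm // mulr_ge0 ?sqr_ge0.
Qed.

Lemma l2_tail_cvg0 x : l2 x ->
  l2norm (fun k => x k - trunc n x k) @[n --> \oo] --> (0 : R).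
Proof.
move=> lx.
have tailE n m : (n <= m)%N ->
    nsq (fun k => x k - trunc n x k) m = nsq x m - nsq x n.
  move=> /subnK <-; elim: (m - n)%N => [|d IH].
    rewrite add0n subrr; apply: big1_seq => k /=.
    by rewrite mem_index_iota /trunc => /andP[_ ->]; rewrite subrr normc0 expr0n.
  by rewrite addSn !nsqS IH /trunc ltnNge leq_addl /= subr0 addrAC.
have bd n : l2norm (fun k => x k - trunc n x k) <= Num.sqrt (l2norm x ^+ 2 - nsq x n).
  apply: l2norm_le; rewrite ?sqrtr_ge0 // => m.
  rewrite sqr_sqrtr ?subr_ge0 ?nsq_le_l2norm //.
  apply: (@le_trans _ _ (nsq (fun k => x k - trunc n x k) (maxn n m))).
    by rewrite nsq_nondecreasing ?leq_maxr.
  by rewrite tailE ?leq_maxl // lerB ?nsq_le_l2norm.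
apply: (@squeeze_cvgr _ _ _ _ (fun=> 0) (fun n => Num.sqrt (l2norm x ^+ 2 - nsq x n))).
- by near=> n; rewrite l2norm_ge0 bd.
- exact: cvg_cst.
- rewrite -(sqrtr0 R) -(subrr (l2norm x ^+ 2)).
  apply: continuous_cvg; first exact: sqrt_continuous.
  by apply: cvgB; [exact: cvg_cst|exact: cvg_nsq].
Unshelve. all: by end_near. Qed.

Lemma cvg_l2_mul x y : l2 x -> l2 y -> cvgn (series (fun k => x k * y k)).
Proof.
move=> lx ly; apply: cvg_series_normc.
apply: (@series_le_cvg _ _ (fun k => normc (x k) ^+ 2 + normc (y k) ^+ 2)).
- by move=> k; exact: normc_ge0.
- by move=> k; rewrite addr_ge0 ?sqr_ge0.
- move=> k; rewrite normc_mul.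
  have := sqr_ge0 (normc (x k) - normc (y k)).
  have := sqr_ge0 (normc (x k)); have := sqr_ge0 (normc (y k)); nra.
- exact: is_cvg_seriesD lx ly.
Qed.

Lemma normc_limn_le (u : nat -> C R) c : cvgn u ->
  (forall n, normc (u n) <= c) -> normc (limn u) <= c.
Proof.
move=> cu uc; apply: ler_cvg_to (cvg_normc cu) (cvg_cst c) _.
by near=> n; exact: uc.
Unshelve. all: by end_near. Qed.

Lemma cauchy_schwarz_l2 x y : l2 x -> l2 y ->
  normc (limn (series (fun k => x k * y k))) <= l2norm x * l2norm y.
Proof.
move=> lx ly; apply: normc_limn_le; first exact: cvg_l2_mul.
move=> n; rewrite -ler_sqr ?nnegrE ?normc_ge0 ?mulr_ge0 ?l2norm_ge0 // exprMn.
apply: le_trans (cauchy_schwarz_series _ _ _) _.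
by apply: ler_pM; rewrite ?nsq_ge0 ?nsq_le_l2norm.
Qed.

Lemma l2dot_sqr x : l2 x -> l2dot x x = ((l2norm x ^+ 2)%:C)%C.
Proof.
move=> lx; apply: cvg_lim; first exact: norm_hausdorff.
rewrite [series _](_ : _ = fun n => ((nsq x n)%:C)%C); last first.
  by apply/funext => n; rewrite nsqE.
exact: cvg_realC (cvg_nsq lx).
Qed.

Lemma l2dot_le x y : l2 x -> l2 y -> normc (l2dot x y) <= l2norm x * l2norm y.
Proof.
by move=> lx ly; rewrite -(l2norm_conj y) cauchy_schwarz_l2 //; exact: l2_conj.
Qed.

Lemma limn_series_lin (a : C R) (u v : nat -> C R) :
  cvgn (series u) -> cvgn (series v) ->
  limn (series (fun k => a * u k + v k)) = a * limn (series u) + limn (series v).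
Proof.
move=> cu cv; apply: cvg_lim; first exact: norm_hausdorff.
rewrite [series _](_ : _ = fun n => a * series u n + series v n); last first.
  by apply/funext => n; rewrite /series /= big_split /= mulr_sumr.
by apply: cvgD; [apply: cvgM; [exact: cvg_cst|exact: cu]|exact: cv].
Qed.

Lemma l2dot_linl (a : C R) x x' y : l2 x -> l2 x' -> l2 y ->
  l2dot (fun k => a * x k + x' k) y = a * l2dot x y + l2dot x' y.
Proof.
move=> lx lx' ly; have ly' := l2_conj ly.
rewrite /l2dot -limn_series_lin; [|exact: cvg_l2_mul..].
by congr (limn (series _)); apply/funext => k; rewrite mulrDl mulrA.
Qed.

End L2.

(** * Matrices with uniformly bounded sections *)

(** A condition on finite sums only, which raises no question of convergence;
    for c >= 0 it means that X defines an operator on l2 of norm at most c. *)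
Definition sections_bounded (R : realType) (X : imx R) (c : R) : Prop :=
  forall n (x : nat -> C R),
    nsq (fun i => series (fun k => X i k * x k) n) n <= c ^+ 2 * nsq x n.

Definition bounded_by (R : realType) (T : (nat -> C R) -> (nat -> C R)) (c : R) :
  Prop := forall x, l2 x -> l2norm (T x) <= c * l2norm x.

Section Operators.
Variable R : realType.
Implicit Types (x y : nat -> C R) (n : nat) (c : R) (X Y : imx R).
Implicit Types T : (nat -> C R) -> (nat -> C R).

Lemma series_finite n m (u : nat -> C R) :
  (forall k, (n <= k)%N -> u k = 0) -> (n <= m)%N -> series u m = series u n.
Proof.
move=> u0 /subnK <-; elim: (m - n)%N => // d IH.
by rewrite addSn seriesSr IH u0 ?addr0 // leq_addl.
Qed.

Lemma cvg_series_finite n (u : nat -> C R) :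
  (forall k, (n <= k)%N -> u k = 0) -> series u m @[m --> \oo] --> series u n.
Proof.
move=> u0; apply: cvg_near_cst; near=> m.
by apply: series_finite => //; near: m; exact: nbhs_infty_ge.
Unshelve. all: by end_near. Qed.

Lemma limn_series_finite n (u : nat -> C R) :
  (forall k, (n <= k)%N -> u k = 0) -> limn (series u) = series u n.
Proof. by move=> /cvg_series_finite h; apply: cvg_lim h; exact: norm_hausdorff. Qed.

Lemma l2_delta k : l2 (delta R k).
Proof.
rewrite (_ : delta R k = trunc k.+1 (delta R k)); first exact: l2_trunc.
apply/funext => m; rewrite /trunc /delta.
by case: ltnP => // km; rewrite gtn_eqF.
Qed.

Lemma l2_cst0 : l2 (fun=> 0 : C R).
Proof.
rewrite (_ : (fun=> 0) = trunc 0 (delta R 0)); first exact: l2_trunc.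
by apply/funext.
Qed.

Lemma l2norm_cst0 : l2norm (fun=> 0 : C R) = 0.
Proof.
have := l2norm_trunc (fun=> 0 : C R) 0; rewrite /nsq /series /= big_nil => /eqP.
by rewrite sqrf_eq0 => /eqP.
Qed.

Let lin_cst0 : (fun _ : nat => 1 * 0 + 0) = (fun=> 0) :> (nat -> C R).
Proof. by apply/funext => k; rewrite mulr0 addr0. Qed.

Lemma normc_le_l2norm x i : l2 x -> normc (x i) <= l2norm x.
Proof.
move=> lx; rewrite -ler_sqr ?nnegrE ?normc_ge0 ?l2norm_ge0 //.
apply: le_trans (nsq_le_l2norm i.+1 lx).
by rewrite nsqS lerDr nsq_ge0.
Qed.

Lemma imx_op_delta X k : imx_op X (delta R k) = fun i => X i k.
Proof.
apply/funext => i; rewrite /imx_op (@limn_series_finite k.+1).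
  rewrite seriesSr /delta eqxx mulr1 /series /= big1_seq ?add0r // => m.
  by rewrite mem_index_iota => /andP[_ mk]; rewrite (ltn_eqF mk) mulr0.
by move=> m km; rewrite /delta gtn_eqF ?mulr0.
Qed.

Lemma series_trunc (a : nat -> C R) n m x : (n <= m)%N ->
  series (fun k => a k * trunc n x k) m = series (fun k => a k * x k) n.
Proof.
move=> nm; rewrite (@series_finite n m) // => [|k nk].
  by apply: eq_big_nat => k /andP[_ kn]; rewrite /trunc kn.
by rewrite /trunc ltnNge nk mulr0.
Qed.

Lemma imx_op_trunc X n x i :
  imx_op X (trunc n x) i = series (fun k => X i k * x k) n.
Proof.
rewrite /imx_op (@limn_series_finite n) ?series_trunc // => k nk.
by rewrite /trunc ltnNge nk mulr0.
Qed.

(** Linearity gives the partial sums as values at truncations of x, and the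
    remainders of x tend to 0 in norm. The composition and the adjoint of
    matrices both reduce to this expansion, with no exchange of series. *)
Lemma bounded_functional_series (phi : (nat -> C R) -> C R) c x :
    (forall a y z, l2 y -> l2 z ->
      phi (fun k => a * y k + z k) = a * phi y + phi z) ->
    (forall y, l2 y -> normc (phi y) <= c * l2norm y) ->
  l2 x -> series (fun k => phi (delta R k) * x k) n @[n --> \oo] --> phi x.
Proof.
move=> lin bd lx.
have phi_trunc n : phi (trunc n x) = series (fun k => phi (delta R k) * x k) n.
  elim: n => [|n IH].
    have := lin 1 _ _ l2_cst0 l2_cst0; rewrite /= lin_cst0.
    rewrite (_ : trunc 0 x = (fun=> 0)) // mul1r => /esym/eqP.
    by rewrite -subr_eq0 addrK /series /= big_nil => /eqP.
  rewrite seriesSr -IH mulrC addrC -lin; [|exact: l2_delta|exact: l2_trunc].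
  congr phi; apply/funext => k; rewrite /trunc /delta ltnS leq_eqVlt.
  by case: eqVneq => [->|_] /=; rewrite ?ltnn ?mulr1 ?addr0 ?mulr0 ?add0r.
apply/cvg_normcP.
have ltail n : l2 (fun k => x k - trunc n x k).
  rewrite (_ : (fun k => _) = (fun k => (-1) * trunc n x k + x k)).
    by apply: l2_lin => //; exact: l2_trunc.
  by apply/funext => k; rewrite mulN1r addrC.
have tail n : phi x - phi (trunc n x) = phi (fun k => x k - trunc n x k).
  rewrite [in phi x](_ : x = fun k => 1 * (x k - trunc n x k) + trunc n x k).
    by rewrite lin ?mul1r ?addrK //; exact: l2_trunc.
  by apply/funext => k; rewrite mul1r subrK.
apply: (@squeeze_cvgr _ _ _ _ (fun=> 0)
  (fun n => c * l2norm (fun k => x k - trunc n x k))).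
- near=> n; rewrite normc_ge0 -phi_trunc normc_subC tail bd //; exact: ltail.
- exact: cvg_cst.
- rewrite -(mulr0 c); apply: cvgM; first exact: cvg_cst.
  exact: l2_tail_cvg0.
Unshelve. all: by end_near. Qed.

Lemma sections_bounded_conj X c :
  sections_bounded X c -> sections_bounded (imx_conj X) c.
Proof.
move=> bX n x; rewrite -(nsq_conj x n); apply: le_trans (bX n _).
rewrite -[leRHS]nsq_conj le_eqVlt; apply/orP; left; apply/eqP.
congr (nsq _ n); apply/funext => i; rewrite /series /= rmorph_sum /=.
by apply: eq_bigr => k _; rewrite rmorphM /= conjCK.
Qed.

(** Duality: if z is the image of y under a transposed section, then the
    square of z is the pairing of y with the image of the conjugate of z. *)
Lemma sections_bounded_tr X c :
  sections_bounded X c -> sections_bounded (imx_tr X) c.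
Proof.
move=> bX n y; set z := fun k => series (fun i => imx_tr X k i * y i) n.
pose w i := series (fun k => X i k * (z k)^*) n.
have zyw : ((nsq z n)%:C)%C = series (fun i => y i * w i) n :> C R.
  rewrite nsqE /w /z /series /=.
  under eq_bigr do rewrite mulr_suml.
  rewrite exchange_big /=; apply: eq_bigr => i _; rewrite mulr_sumr.
  by apply: eq_bigr => k _; rewrite /imx_tr mulrA (mulrC (y i)).
have wz : nsq w n <= c ^+ 2 * nsq z n by rewrite -(nsq_conj z n); exact: bX.
have := cauchy_schwarz_series y w n; rewrite -zyw normc_real ger0_norm ?nsq_ge0 //.
have [->|z0] := eqVneq (nsq z n) 0.
  by move=> _; rewrite mulr_ge0 ?sqr_ge0 ?nsq_ge0.
have zpos : 0 < nsq z n by rewrite lt_neqAle eq_sym z0 nsq_ge0.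
move=> le_z; rewrite -(ler_pM2r zpos) -expr2; apply: le_trans le_z _.
by rewrite mulrC -mulrAC ler_wpM2r ?nsq_ge0.
Qed.

(** Applying the section to the conjugate of its own row squares the norm of
    that row, so that the norm itself is bounded. *)
Lemma sections_bounded_row_l2 X c i : sections_bounded X c -> l2 (X i).
Proof.
move=> bX; have big n : (i < n)%N -> nsq (X i) n <= c ^+ 2.
  move=> i_n; have := bX n (fun k => (X i k)^*); rewrite nsq_conj.
  set v := fun j => _; have vi : v i = ((nsq (X i) n)%:C)%C by rewrite nsqE.
  have vn : nsq (X i) n ^+ 2 <= nsq v n.
    rewrite -[nsq (X i) n]ger0_norm ?nsq_ge0 // -normc_real -vi.
    apply: le_trans (nsq_nondecreasing v i_n).
    by rewrite nsqS lerDr nsq_ge0.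
  move=> /(le_trans vn); have [->|r0] := eqVneq (nsq (X i) n) 0.
    by rewrite sqr_ge0.
  by rewrite expr2 ler_pM2r // lt_neqAle eq_sym r0 nsq_ge0.
apply: (@l2_bounded _ _ (c ^+ 2)) => n.
apply: le_trans (nsq_nondecreasing _ (leq_maxr i.+1 n)) _.
by apply: big; exact: leq_maxl.
Qed.

Lemma cvg_nsq_pointwise (v : nat -> nat -> C R) y N :
    (forall i, v n i @[n --> \oo] --> y i) ->
  nsq (v n) N @[n --> \oo] --> nsq y N.
Proof.
move=> vy; elim: N => [|N IH].
  rewrite /nsq /series /= !big_nil; under eq_fun do rewrite big_nil.
  exact: cvg_cst.
rewrite nsqS; under eq_fun do rewrite nsqS.
by apply: cvgD IH _; rewrite expr2; under eq_fun do rewrite expr2;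
  apply: cvgM; exact: cvg_normc.
Qed.

Lemma sections_bounded_cvg X c x i : sections_bounded X c -> l2 x ->
  series (fun k => X i k * x k) n @[n --> \oo] --> imx_op X x i.
Proof.
by move=> bX lx; apply: cvg_l2_mul => //; exact: sections_bounded_row_l2 bX.
Qed.

Lemma sections_bounded_nsq X c x N : sections_bounded X c -> l2 x ->
  nsq (imx_op X x) N <= c ^+ 2 * l2norm x ^+ 2.
Proof.
move=> bX lx.
have h := @cvg_nsq_pointwise _ _ N (fun i => @sections_bounded_cvg X c x i bX lx).
apply: ler_cvg_to h (cvg_cst (c ^+ 2 * l2norm x ^+ 2)) _.
near=> n; apply: (@le_trans _ _ (c ^+ 2 * nsq x n)).
  apply: le_trans (bX n x); apply: nsq_nondecreasing.
  by near: n; exact: nbhs_infty_ge.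
by rewrite ler_wpM2l ?sqr_ge0 ?nsq_le_l2norm.
Unshelve. all: by end_near. Qed.

Lemma sections_bounded_by X c : 0 <= c -> sections_bounded X c ->
  bounded_by (imx_op X) c.
Proof.
move=> c0 bX x lx; apply: l2norm_le => [|n]; first by rewrite mulr_ge0 ?l2norm_ge0.
by rewrite exprMn; exact: sections_bounded_nsq.
Qed.

Lemma sections_bounded_l2 X c x : sections_bounded X c -> l2 x ->
  l2 (imx_op X x).
Proof.
by move=> bX lx; apply: (@l2_bounded _ _ (c ^+ 2 * l2norm x ^+ 2)) => n;
  exact: sections_bounded_nsq.
Qed.

Lemma sections_bounded_lin X c a x y : sections_bounded X c -> l2 x -> l2 y ->
  imx_op X (fun k => a * x k + y k) = fun k => a * imx_op X x k + imx_op X y k.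
Proof.
move=> bX lx ly; apply/funext => i; have lX := @sections_bounded_row_l2 X c i bX.
rewrite /imx_op -limn_series_lin; [|exact: cvg_l2_mul..].
by congr (limn (series _)); apply/funext => k; rewrite mulrDr mulrCA.
Qed.

Lemma sections_bounded_operator X c : 0 <= c -> sections_bounded X c ->
  defines_bounded_operator X.
Proof.
move=> c0 bX; split.
  move=> x lx i; apply/cvg_ex; exists (imx_op X x i).
  exact: sections_bounded_cvg bX lx.
split; first by move=> x; exact: sections_bounded_l2 bX.
  by move=> a x y; exact: sections_bounded_lin bX.
by exists c; exact: sections_bounded_by.
Qed.

Lemma bounded_by_sections X c : defines_bounded_operator X ->
  bounded_by (imx_op X) c -> sections_bounded X c.
Proof.
move=> [_ [l2X _ _]] bX n x; have lt := @l2_trunc _ x n.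
rewrite -(l2norm_trunc x n) -exprMn.
rewrite (_ : (fun i => _) = imx_op X (trunc n x)); last first.
  by apply/funext => i; rewrite imx_op_trunc.
apply: le_trans (nsq_le_l2norm n (l2X _ lt)) _.
rewrite ler_sqr ?nnegrE ?l2norm_ge0 //; first exact: bX.
exact: le_trans (l2norm_ge0 _) (bX _ lt).
Qed.

Lemma sections_bounded_adjoint X c : 0 <= c -> sections_bounded X c ->
  adjoint (imx_op X) (imx_op (imx_tr (imx_conj X))).
Proof.
move=> c0 bX; have bS := sections_bounded_tr (sections_bounded_conj bX).
split=> [|x y lx ly]; first by case: (sections_bounded_operator c0 bS).
have lop z (lz : l2 z) := sections_bounded_l2 bX lz.
pose u k := l2dot (imx_op X (delta R k)) y * x k.
transitivity (limn (series u)).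
  apply/esym; apply: cvg_lim; first exact: norm_hausdorff.
  apply: (@bounded_functional_series (fun z => l2dot (imx_op X z) y)
    (c * l2norm y) x _ _ lx).
    move=> a z t lz lt; rewrite (sections_bounded_lin _ bX lz lt).
    by rewrite l2dot_linl //; exact: lop.
  move=> z lz; apply: le_trans (l2dot_le (lop z lz) ly) _.
  by rewrite mulrAC ler_wpM2r ?l2norm_ge0 // sections_bounded_by.
congr (limn (series _)); apply/funext => k; rewrite /u imx_op_delta mulrC.
congr (_ * _); apply: cvg_lim; first exact: norm_hausdorff.
rewrite [series _](_ : _ =
    fun n => (series (fun i => imx_tr (imx_conj X) k i * y i) n)^*); last first.
  apply/funext => n; rewrite /series /= rmorph_sum /=; apply: eq_bigr => i _.
  by rewrite rmorphM /= /imx_tr /imx_conj conjCK.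
by apply: cvg_conjC; exact: (@sections_bounded_cvg _ c).
Qed.

(** The columns of the product matrix are the images of the standard basis under
    the composite operator, and its rows expand the coordinates of the latter. *)
Lemma sections_bounded_mul X Y c d : 0 <= c -> 0 <= d ->
    sections_bounded X c -> sections_bounded Y d ->
  [/\ imx_mul_exists X Y, defines_bounded_operator (imx_mul X Y)
    & forall x, l2 x -> imx_op (imx_mul X Y) x = imx_op X (imx_op Y x)].
Proof.
move=> c0 d0 bX bY.
have lcol k : l2 (fun m => Y m k).
  exact: (@sections_bounded_row_l2 (imx_tr Y) d k (sections_bounded_tr bY)).
have lY x (lx : l2 x) := sections_bounded_l2 bY lx.
have bXY x : l2 x -> l2norm (imx_op X (imx_op Y x)) <= c * d * l2norm x.
  move=> lx; apply: le_trans (sections_bounded_by c0 bX (lY x lx)) _.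
  by rewrite -mulrA ler_wpM2l // sections_bounded_by.
have cXY x i : l2 x -> series (fun k => imx_mul X Y i k * x k) n @[n --> \oo]
    --> imx_op X (imx_op Y x) i.
  move=> lx.
  have -> : (fun k => imx_mul X Y i k * x k) =
      (fun k => imx_op X (imx_op Y (delta R k)) i * x k).
    by apply/funext => k; rewrite imx_op_delta.
  apply: (@bounded_functional_series (fun z => imx_op X (imx_op Y z) i)
    (c * d) x _ _ lx) => [a y z ly lz|y ly].
    rewrite (sections_bounded_lin _ bY ly lz).
    by rewrite (sections_bounded_lin _ bX (lY y ly) (lY z lz)).
  apply: le_trans (bXY y ly); apply: normc_le_l2norm.
  by apply: sections_bounded_l2 bX _; exact: lY.
have opE x : l2 x -> imx_op (imx_mul X Y) x = imx_op X (imx_op Y x).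
  move=> lx; apply/funext => i; apply: cvg_lim (cXY x i lx).
  exact: norm_hausdorff.
split; [|split|exact: opE].
- move=> i j; apply: cvg_l2_mul; last exact: lcol.
  exact: sections_bounded_row_l2 bX.
- by move=> x lx i; apply/cvg_ex; eexists; exact: cXY.
split=> [x lx|a x y lx ly|].
- by rewrite opE //; apply: sections_bounded_l2 bX _; exact: lY.
- rewrite !opE //; last exact: l2_lin.
  rewrite (sections_bounded_lin _ bY lx ly).
  by rewrite (sections_bounded_lin _ bX (lY x lx) (lY y ly)).
- by exists (c * d) => x lx; rewrite opE //; exact: bXY.
Qed.

Lemma l2norm_scale (a : C R) x : l2 x ->
  l2norm (fun k => a * x k) = normc a * l2norm x.
Proof.
move=> lx; have nsqa n : nsq (fun k => a * x k) n = normc a ^+ 2 * nsq x n.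
  rewrite /nsq /series /= mulr_sumr; apply: eq_bigr => k _.
  by rewrite normc_mul exprMn.
have lax : l2 (fun k => a * x k).
  apply: (@l2_bounded _ _ (normc a ^+ 2 * l2norm x ^+ 2)) => n.
  by rewrite nsqa ler_wpM2l ?sqr_ge0 ?nsq_le_l2norm.
apply/eqP; rewrite -(@eqrXn2 _ 2) ?mulr_ge0 ?normc_ge0 ?l2norm_ge0 //.
rewrite exprMn; apply/eqP; have := cvg_nsq lax.
rewrite (_ : nsq _ = (fun n => normc a ^+ 2 * nsq x n)); last exact/funext.
move=> /cvg_unique; apply; first exact: norm_hausdorff.
by apply: cvgM; [exact: cvg_cst|exact: cvg_nsq].
Qed.

Lemma opnorm_le T c : 0 <= c -> bounded_by T c -> opnorm T <= c.
Proof.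
move=> c0 bT; apply: ge_sup.
  exists (l2norm (T (fun=> 0))); exists (fun=> 0) => //.
  by split; [exact: l2_cst0|rewrite l2norm_cst0 ler01].
move=> _ [x [lx x1] <-]; apply: le_trans (bT x lx) _.
by rewrite -[leRHS]mulr1 ler_wpM2l ?normr_ge0.
Qed.

Lemma opnorm_has_ubound T : bounded_operator T ->
  has_ubound [set l2norm (T x) | x in [set x | l2 x /\ l2norm x <= 1]].
Proof.
move=> [_ _ [c bT]]; exists `|c| => _ [x [lx x1] <-].
apply: le_trans (bT x lx) _.
apply: (@le_trans _ _ (`|c| * l2norm x)).
  by rewrite ler_wpM2r ?l2norm_ge0 // ler_norm.
by rewrite -[leRHS]mulr1 ler_wpM2l ?normr_ge0.
Qed.

Lemma opnorm_ge0 T : bounded_operator T -> 0 <= opnorm T.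
Proof.
move=> bT; apply: le_trans (l2norm_ge0 (T (fun=> 0))) _.
apply: ub_le_sup; first exact: opnorm_has_ubound.
exists (fun=> 0) => //; split; [exact: l2_cst0|by rewrite l2norm_cst0 ler01].
Qed.

Lemma opnorm_bounded_by T : bounded_operator T -> bounded_by T (opnorm T).
Proof.
move=> bT; have [l2T linT [c cT]] := bT; move=> x lx.
have [x0|x0] := eqVneq (l2norm x) 0.
  by have := cT x lx; rewrite x0 !mulr0.
have xpos : 0 < l2norm x by rewrite lt_neqAle eq_sym x0 l2norm_ge0.
pose a : C R := (((l2norm x)^-1)%:C)%C.
have na : normc a = (l2norm x)^-1 by rewrite normc_real ger0_norm ?invr_ge0 ?l2norm_ge0.
have T0 : T (fun=> 0) = fun=> 0.
  apply/funext => k; have := linT 1 _ _ l2_cst0 l2_cst0; rewrite /= lin_cst0.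
  move=> /(congr1 (fun f => f k)) /esym/eqP.
  by rewrite mul1r -subr_eq0 addrK => /eqP.
have axE : (fun k => a * x k) = (fun k => a * x k + 0).
  by apply/funext => k; rewrite addr0.
have Tax : T (fun k => a * x k) = fun k => a * T x k.
  rewrite axE (linT a x (fun=> 0) lx l2_cst0) T0.
  by apply/funext => k; rewrite addr0.
rewrite -ler_pdivrMr // mulrC -na -l2norm_scale; last exact: l2T.
rewrite -Tax; apply: ub_le_sup; first exact: opnorm_has_ubound.
exists (fun k => a * x k) => //; split.
  by rewrite axE; apply: l2_lin lx l2_cst0.
by rewrite l2norm_scale // na mulVf.
Qed.

End Operators.

(** * Orthonormal polynomials and the smallest eigenvalues *)

Local Open Scope sesquilinear_scope.

Section Rayleigh.
Variable R : realType.

(** Rayleigh's principle: in a unitary basis of eigenvectors the form of a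
    Hermitian matrix is a sum of squares weighted by eigenvalues. *)
Lemma smallest_eigenvalue_le n (X : 'M[C R]_n) (l : R) (v : 'rV[C R]_n) :
    X \is hermsymmx -> smallest_eigenvalue X l ->
  ((l%:C)%C : C R) * (v *m v ^t* ) 0 0 <= (v *m X *m v ^t* ) 0 0.
Proof.
move=> hX [_ lmin].
have nX := hermitian_normalmx hX.
set P := spectralmx X; set d := spectral_diag X.
have PU : P \is unitarymx := spectral_unitarymx X.
have XE : X = P ^t* *m diag_mx d *m P.
  by rewrite -(invmx_unitary PU); apply/orthomx_spectralP.
have PX : P *m X = diag_mx d *m P.
  by rewrite XE !mulmxA (unitarymxP PU) mul1mx.
have dmin i : ((l%:C)%C : C R) <= d 0 i.
  apply: lmin; apply/eigenvalueP; exists (row i P).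
    by rewrite -row_mul PX; apply/rowP => j; rewrite mul_diag_mx !mxE.
  apply/eqP => Pi0; have := unitarymxP PU => /row_matrixP /(_ i).
  rewrite row_mul Pi0 mul0mx row1 => /matrixP /(_ 0 i) /eqP.
  by rewrite !mxE !eqxx eq_sym oner_eq0.
pose w := v *m P ^t*.
have wt : w ^t* = P *m v ^t*.
  by rewrite /w trmx_mul map_mxM /= trmxCK.
have -> : v *m X *m v ^t* = w *m diag_mx d *m w ^t*.
  by rewrite XE wt /w !mulmxA.
have -> : v *m v ^t* = w *m w ^t*.
  rewrite wt /w mulmxA -(mulmxA v) -(invmx_unitary PU).
  by rewrite mulVmx ?mulmx1 // unitarymx_unit.
clearbody w; rewrite !mxE mulr_sumr; apply: ler_sum => i _.
rewrite mul_mx_diag !mxE (mulrC (w 0 i) (d 0 i)) -mulrA.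
apply: ler_wpM2r; [exact: mul_conjC_ge0|exact: dmin].
Qed.

End Rayleigh.

Section TransitionMatrix.
Variables (R : realType) (M B : imx R).
Hypothesis MB : transition_matrix M B.
Implicit Types (n : nat) (x : nat -> C R).

Let rowseq n x : 'rV[C R]_n.+1 := \row_i x i.

Lemma mulmx_adj_nsq n (v : 'rV[C R]_n.+1) x : (forall i, v 0 i = x i) ->
  (v *m v ^t* ) 0 0 = ((nsq x n.+1)%:C)%C.
Proof.
move=> vx; rewrite nsqE /series /= big_mkord !mxE.
by apply: eq_bigr => i _; rewrite !mxE vx.
Qed.

Lemma poly_dot_widen (p q : {poly (C R)}) N :
    (size p <= N)%N -> (size q <= N)%N ->
  poly_dot M p q = \sum_(i < N) \sum_(j < N) p`_i * (q`_j)^* * M i j.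
Proof.
move=> pN qN; rewrite /poly_dot.
rewrite (big_ord_widen N (fun i => \sum_(j < size q) p`_i * (q`_j)^* * M i j) pN).
rewrite big_mkcond /=; apply: eq_bigr => i _; case: ltnP => [_|/(nth_default 0) ->].
  rewrite (big_ord_widen N (fun j => p`_i * (q`_j)^* * M i j) qN).
  rewrite big_mkcond /=; apply: eq_bigr => j _; case: ltnP => // /(nth_default 0) ->.
  by rewrite conjC0 mulr0 mul0r.
by rewrite big1 // => j _; rewrite !mul0r.
Qed.

(** The (p, q) entry of the product is the inner product of the p-th and q-th
    orthonormal polynomials, with sums extended to a common length. *)
Lemma transition_matrix_orthonormal n :
  (section B n)^T *m section M n *m section (imx_conj B) n = 1%:M.
Proof.
case: MB => P [sP _ oP] BE; apply/matrixP => p q; rewrite !mxE.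
rewrite -[RHS]oP (@poly_dot_widen _ _ n.+1) ?sP ?ltn_ord // [RHS]exchange_big /=.
apply: eq_bigr => j _; rewrite !mxE mulr_suml; apply: eq_bigr => i _.
by rewrite !mxE /imx_conj !BE mulrAC.
Qed.

Lemma invmx_section n :
  invmx (section M n) = section (imx_conj B) n *m (section B n)^T.
Proof.
have /mulmx1C := transition_matrix_orthonormal n; rewrite mulmxA => h.
have /mulmx1_unit[_ Mu] := h.
by rewrite -[RHS]mulmx1 -(mulmxV Mu) mulmxA h mul1mx.
Qed.

Hypothesis HM : HPD M.

Lemma section_hermitian n : section M n \is hermsymmx.
Proof.
apply/is_hermitianmxP; rewrite expr0 scale1r.
by apply/matrixP => i j; rewrite !mxE; case: HM => -> _.
Qed.

Variable l : nat -> R.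
Hypothesis Hl : forall n, smallest_eigenvalue (section M n) (l n).

(** For the polynomial with coordinates x in the orthonormal basis, the
    coefficient vector is the image of x under the section of B, and the form
    of M takes the value |x|^2 on it. *)
Lemma transition_section_le n x :
  l n * nsq (fun i => series (fun k => B i k * x k) n.+1) n.+1 <= nsq x n.+1.
Proof.
pose v := rowseq n x *m (section B n)^T.
set y := fun i => _; have vE i : v 0 i = y i.
  rewrite /v /y /series /= big_mkord !mxE; apply: eq_bigr => k _.
  by rewrite !mxE mulrC.
have := smallest_eigenvalue_le v (section_hermitian n) (Hl n).
rewrite (@mulmx_adj_nsq _ v y vE).
have -> : v *m section M n *m v ^t* = rowseq n x *m (rowseq n x) ^t*.
  have -> : v ^t* = section (imx_conj B) n *m (rowseq n x) ^t*.
    rewrite /v trmx_mul map_mxM /= trmxK; congr (_ *m _).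
    by apply/matrixP => i j; rewrite !mxE.
  rewrite /v !mulmxA -(mulmxA (rowseq n x)).
  by rewrite -(mulmxA (rowseq n x)) transition_matrix_orthonormal mulmx1.
rewrite (@mulmx_adj_nsq _ _ x) => [|i]; last by rewrite mxE.
by rewrite -rmorphM lecR.
Qed.

(** An eigenvector v of the section of M is one of its inverse, which is the
    Gram matrix of the rows of the section of B: the adjoint section maps v to
    a vector of squared norm |v|^2 / l n. *)
Lemma transition_adjoint_section n : exists x,
  0 < nsq x n.+1 /\ nsq x n.+1 =
  l n * nsq (fun k => series (fun i => imx_tr (imx_conj B) k i * x i) n.+1) n.+1.
Proof.
have [/eigenvalueP [v vM v0] _] := Hl n.
pose x i := v 0 (inord i).
have vx i : v 0 i = x i by rewrite /x inord_val.
exists x; split.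
  rewrite lt_neqAle nsq_ge0 andbT eq_sym; apply: contraNneq v0 => x0.
  apply/eqP/rowP => i; rewrite mxE vx; apply: eq0_normc.
  apply/eqP; rewrite -sqrf_eq0 eq_le sqr_ge0 andbT -x0.
  apply: le_trans (nsq_nondecreasing x (ltn_ord i)).
  by rewrite nsqS lerDr nsq_ge0.
pose w := v *m section (imx_conj B) n.
set y := fun k => _; have wE k : w 0 k = y k.
  rewrite /w /y /series /= big_mkord !mxE; apply: eq_bigr => i _.
  by rewrite !mxE mulrC vx.
apply: (@complexI R); rewrite rmorphM /=.
rewrite -(@mulmx_adj_nsq _ w y wE) -(@mulmx_adj_nsq _ v x vx).
have wt : w ^t* = (section B n)^T *m v ^t*.
  rewrite /w trmx_mul map_mxM /=; congr (_ *m _).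
  by apply/matrixP => i j; rewrite !mxE /imx_conj conjCK.
have /mulmx1C := transition_matrix_orthonormal n; rewrite mulmxA => /mulmx1C MK.
rewrite -{1}(mulmx1 v) -MK !mulmxA vM -!scalemxAl -/w -mulmxA -wt.
by rewrite mxE.
Qed.

Variable lambda : R.
Hypothesis Hlambda : l n @[n --> \oo] --> lambda.
Hypothesis lambda_gt0 : 0 < lambda.

(** A section of B is contained in all larger ones, so that its norm is bounded
    by means of l m for arbitrarily large m. *)
Lemma transition_sections_bounded : sections_bounded B (Num.sqrt lambda^-1).
Proof.
have lambda_ge0 := ltW lambda_gt0.
move=> n x; rewrite sqr_sqrtr ?invr_ge0 // ler_pdivlMl //.
set p := nsq _ n.
apply: ler_cvg_to (cvgM Hlambda (cvg_cst p)) (cvg_cst (nsq x n)) _.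
near=> m; have nm : (n <= m.+1)%N.
  by apply: leqW; near: m; exact: nbhs_infty_ge.
have l0 : 0 <= l m.
  by apply: ltW; near: m; exact: cvgr_gt Hlambda _ lambda_gt0.
apply: (@le_trans _ _ (nsq (trunc n x) m.+1)); last first.
  by rewrite nsq_trunc (minn_idPr nm).
apply: le_trans (transition_section_le m _).
rewrite ler_wpM2l //; apply: le_trans (nsq_nondecreasing _ nm).
rewrite le_eqVlt; apply/orP; left; apply/eqP; congr (nsq _ n).
by apply/funext => i; rewrite series_trunc.
Unshelve. all: by end_near. Qed.

Lemma transition_adjoint_lower c :
  sections_bounded (imx_tr (imx_conj B)) c -> lambda^-1 <= c ^+ 2.
Proof.
move=> bS; rewrite -[leLHS]mul1r ler_pdivrMr // mulrC.
have lim : l n * c ^+ 2 @[n --> \oo] --> lambda * c ^+ 2.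
  by apply: cvgM Hlambda _; exact: cvg_cst.
apply: ler_cvg_to (cvg_cst (1 : R)) lim _.
near=> n; have [x [+ +]] := transition_adjoint_section n.
have := bS n.+1 x; set s := nsq _ _; set t := nsq _ _ => sx x0 E.
have ln0 : 0 <= l n.
  rewrite leNgt; apply/negP => ln; have := x0; rewrite E ltNge => /negP; apply.
  by apply: mulr_le0_ge0; [exact: ltW|exact: nsq_ge0].
rewrite -(ler_pM2r x0) mul1r {1}E -mulrA.
exact: ler_wpM2l.
Unshelve. all: by end_near. Qed.

End TransitionMatrix.

Section CStar.
Variable R : realType.

Lemma imx_conjK (X : imx R) : imx_conj (imx_conj X) = X.
Proof. by apply/funext => i; apply/funext => j; rewrite /imx_conj conjCK. Qed.

(** The nontrivial half of the C*-identity: |S x|^2 = <T (S x), x> is at most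
    a |x|^2. *)
Lemma adjoint_bounded_by (T S : (nat -> C R) -> (nat -> C R)) (a : R) :
    0 <= a -> bounded_operator T -> adjoint T S ->
  bounded_by (fun x => T (S x)) a -> bounded_by S (Num.sqrt a).
Proof.
move=> a0 [l2T _ _] [[l2S _ _] adj] bTS x lx; have lS := l2S x lx.
rewrite -ler_sqr ?nnegrE ?l2norm_ge0 ?mulr_ge0 ?sqrtr_ge0 //.
rewrite exprMn (sqr_sqrtr a0).
rewrite -[leLHS]ger0_norm ?sqr_ge0 // -normc_real -l2dot_sqr // -adj //.
apply: le_trans (l2dot_le (l2T _ lS) lx) _.
rewrite expr2 mulrA; apply: ler_wpM2r; first exact: l2norm_ge0.
exact: bTS.
Qed.

End CStar.

Theorem lemma2 (R : realType) (M B : imx R) (l : nat -> R) (lambda : R) :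
  HPD M ->
  (forall n, smallest_eigenvalue (section M n) (l n)) ->
  l n @[n --> \oo] --> lambda ->
  0 < lambda ->
  transition_matrix M B ->
  let A := imx_mul (imx_conj B) (imx_tr B) in
  [/\ imx_mul_exists (imx_conj B) (imx_tr B),
      [/\ defines_bounded_operator B,
          defines_bounded_operator (imx_conj B)
        & defines_bounded_operator A],
      (exists2 S, adjoint (imx_op (imx_conj B)) S
         & forall x, l2 x -> imx_op A x = imx_op (imx_conj B) (S x)),
      (forall i j : nat,
         invmx (section M n) (inord i) (inord j) @[n --> \oo] --> A i j)
    & opnorm (imx_op A) = opnorm (imx_op B) ^+ 2 /\
      opnorm (imx_op B) ^+ 2 = lambda^-1].
Proof.
move=> HM Hl Hlambda lambda_gt0 MB A.
set c := Num.sqrt lambda^-1; have c0 : 0 <= c := sqrtr_ge0 _.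
have c2 : c ^+ 2 = lambda^-1 by rewrite sqr_sqrtr // invr_ge0 ltW.
have bB : sections_bounded B c.
  exact: (transition_sections_bounded MB HM Hl Hlambda lambda_gt0).
have bBc := sections_bounded_conj bB; have bBt := sections_bounded_tr bB.
have lower d : sections_bounded (imx_tr (imx_conj B)) d -> lambda^-1 <= d ^+ 2.
  exact: (transition_adjoint_lower MB Hl Hlambda lambda_gt0).
have opB := sections_bounded_operator c0 bB.
have opBc := sections_bounded_operator c0 bBc.
have opBt := sections_bounded_operator c0 bBt.
have [exA opA AE] := sections_bounded_mul c0 c0 bBc bBt.
have adjS : adjoint (imx_op (imx_conj B)) (imx_op (imx_tr B)).
  by have := sections_bounded_adjoint c0 bBc; rewrite imx_conjK.
have normB : opnorm (imx_op B) ^+ 2 = lambda^-1.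
  have b0 := opnorm_ge0 opB.2; apply/eqP; rewrite eq_le; apply/andP; split.
    by rewrite -c2 ler_sqr ?nnegrE // opnorm_le //; exact: sections_bounded_by.
  apply: lower; apply: sections_bounded_tr; apply: sections_bounded_conj.
  by apply: bounded_by_sections => //; apply: opnorm_bounded_by; case: opB.
split=> //.
- by exists (imx_op (imx_tr B)).
- move=> i j; have : series (fun k => imx_conj B i k * imx_tr B k j) n.+1
      @[n --> \oo] --> A i j.
    by rewrite (cvg_shiftS (series _)); exact: exA.
  apply: cvg_trans; apply: near_eq_cvg; near=> n.
  have i_n : (i < n.+1)%N by rewrite ltnS; near: n; exact: nbhs_infty_ge.
  have jn : (j < n.+1)%N by rewrite ltnS; near: n; exact: nbhs_infty_ge.
  rewrite (invmx_section MB) /series /= big_mkord !mxE.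
  by apply: eq_bigr => k _; rewrite !mxE !inordK.
- split=> //; rewrite normB.
  have a0 := opnorm_ge0 opA.2; apply/eqP; rewrite eq_le; apply/andP; split.
    apply: opnorm_le => [|x lx]; first by rewrite invr_ge0 ltW.
    rewrite AE // -c2 expr2 -mulrA.
    have lS : l2 (imx_op (imx_tr B) x) := sections_bounded_l2 bBt lx.
    apply: le_trans (sections_bounded_by c0 bBc lS) _.
    by rewrite ler_wpM2l // sections_bounded_by.
  rewrite -[leRHS]sqr_sqrtr //; apply: lower.
  apply: (@sections_bounded_conj _ (imx_tr B)); apply: bounded_by_sections => //.
  apply: (adjoint_bounded_by a0 opBc.2 adjS) => x lx.
  by rewrite -AE //; apply: opnorm_bounded_by => //; case: opA.
Unshelve. all: by end_near. Qed.
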